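(* For all integers $n \geq 0$, $$dp(27n+7) \equiv dp(3n+1) \pmod{3}.$$
   Context: A partition of a positive integer $n$ is a nonincreasing sequence of positive integers (called parts) whose sum is $n$. For $n\ge 0$, $dp(n)$ denotes the number of partitions of $n$ in which every part is either divisible by $4$ or congruent to $\pm 1 \pmod 6$ (with $dp(0)=1$). Equivalently, its generating function is $$\sum_{n=0}^{\infty} dp(n)q^n = \frac{1}{(q;q^6)_\infty (q^5;q^6)_\infty (q^4;q^4)_\infty},$$ where $(a;q)_\infty := (1-a)(1-aq)(1-aq^2)\cdots$. *)

(* Defs.v *)
From mathcomp Require Import all_boot.

Set Implicit Arguments.
Unset Strict Implicit.
Unset Printing Implicit Defensive.

Definition is_partition (n : nat) (s : seq nat) : bool :=
  [&& sorted geq s, all (leq 1) s & sumn s == n].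

Definition dp_part (k : nat) : bool :=
  [|| 4 %| k, k == 1 %[mod 6] | k == 5 %[mod 6]].

Definition is_dp_partition (n : nat) (s : seq nat) : bool :=
  is_partition n s && all dp_part s.

(* A partition of n has at most n parts, each at most n, so partitions of n are
   counted inside the finite type of sequences of length at most n with entries
   in 'I_n.+1; [dp_count] shows that this bound loses none of them. *)
Definition dp (n : nat) : nat :=
  #|[set s : n.-bseq 'I_n.+1 | is_dp_partition n (map val s)]|.

Lemma size_le_sumn (s : seq nat) : all (leq 1) s -> size s <= sumn s.
Proof. by elim: s => //= x s IH /andP[x0 /IH ss]; rewrite -add1n leq_add. Qed.

Lemma mem_le_sumn (s : seq nat) x : x \in s -> x <= sumn s.
Proof.
elim: s => //= y s IH; rewrite inE => /predU1P[->|/IH h]; first exact: leq_addr.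
exact: leq_trans h (leq_addl _ _).
Qed.

Lemma dp_count (n : nat) :
  exists l : seq (seq nat),
    [/\ uniq l, l =i is_dp_partition n & size l = dp n].
Proof.
pose A := [set s : n.-bseq 'I_n.+1 | is_dp_partition n (map val s)].
exists [seq map val (val s) | s : n.-bseq 'I_n.+1 <- enum A]; split.
- rewrite map_inj_uniq ?enum_uniq // => s t /(inj_map val_inj).
  exact: val_inj.
- move=> s; apply/mapP/idP => [[t]|].
    by rewrite mem_enum inE => ht ->.
  rewrite unfold_in => hs.
  have /andP[/and3P[_ s0 /eqP ss] _] := hs.
  have le_s x : x \in s -> x < n.+1 by rewrite ltnS -ss; apply: mem_le_sumn.
  pose t : seq 'I_n.+1 := map inord s.
  have vt : map val t = s.
    by rewrite -map_comp -[RHS]map_id; apply/eq_in_map => x /le_s /inordK.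
  have st : size t <= n by rewrite size_map -ss size_le_sumn.
  by exists (Bseq st); rewrite ?mem_enum ?inE /= vt.
- by rewrite size_map -cardE.
Qed.

(* Main.v *)
(* Write E_k = prod_(i > 0) (1 - q^(ki)). The generating function of dp is
   F = E_2 E_3 / (E_1 E_4 E_6). Over F_3 one has E_(3k) = E_k^3, and Jacobi's
   triple product turns F into phi_1 phi_2 / E_2^3, where
   phi_d = sum_(k in Z) (-1)^k q^(d k^2) = E_d^2 / E_(2d). Since f^3 is f(q^3)
   over F_3, splitting squares modulo 3 gives
   phi_d = phi_d^9 + q^d omega_d^3 with
   omega_d = sum_(k in Z) (-1)^k q^(d (3 k^2 + 2 k)), and
   omega_1 = E_2^5 / E_1^2. Reading off residue classes of exponents,
     sum dp(3n+1) q^n  = omega_1 phi_2^3 / E_2 = E_2^10 / (E_1^2 E_4^3)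
                       = E_2^12 phi_1^2 / (E_4 E_1^2)^3,
     sum dp(9n+7) q^n  = E_2^4 omega_1^2 / (E_4 E_1^2)
                       = E_2^12 phi_2 / E_1^6,
     sum dp(27n+7) q^n = E_2^4 phi_2^3 / E_1^2 = E_2^10 / (E_1^2 E_4^3). *)
Require Import Defs.
From HB Require Import structures.
From mathcomp Require Import all_boot all_algebra ring zify boolp.

Set Implicit Arguments.
Unset Strict Implicit.
Unset Printing Implicit Defensive.

Import GRing.Theory.
Local Open Scope ring_scope.

Record fps (R : comNzRingType) := Fps { fps_coef :> nat -> R }.

Section FormalPowerSeries.
Variable R : comNzRingType.
Implicit Types (f g h : fps R) (n N : nat).

HB.instance Definition _ := gen_eqMixin (fps R).
HB.instance Definition _ := gen_choiceMixin (fps R).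

Lemma fpsP f g : f =1 g -> f = g.
Proof. by case: f g => f [g] /= /funext ->. Qed.

Definition fps_zero : fps R := Fps (fun=> 0).
Definition fps_opp f : fps R := Fps (fun n => - f n).
Definition fps_add f g : fps R := Fps (fun n => f n + g n).

Fact fps_addA : associative fps_add.
Proof. by move=> f g h; apply: fpsP => n /=; rewrite addrA. Qed.
Fact fps_addC : commutative fps_add.
Proof. by move=> f g; apply: fpsP => n /=; rewrite addrC. Qed.
Fact fps_add0 : left_id fps_zero fps_add.
Proof. by move=> f; apply: fpsP => n /=; rewrite add0r. Qed.
Fact fps_addN : left_inverse fps_zero fps_opp fps_add.
Proof. by move=> f; apply: fpsP => n /=; rewrite addNr. Qed.

HB.instance Definition _ :=
  GRing.isZmodule.Build (fps R) fps_addA fps_addC fps_add0 fps_addN.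

Definition fps_one : fps R := Fps (fun n => (n == 0)%:R).
Definition fps_mul f g : fps R :=
  Fps (fun n => \sum_(i < n.+1) f i * g (n - i)%N).

Let agree n f (p : {poly R}) := forall k, (k <= n)%N -> f k = p`_k.

Let trunc n f := \poly_(i < n.+1) f i.

Let agree_trunc n f : agree n f (trunc n f).
Proof. by move=> k le_kn; rewrite coef_poly ltnS le_kn. Qed.

Let agree_mul n f g p r :
  agree n f p -> agree n g r -> agree n (fps_mul f g) (p * r).
Proof.
move=> fp gr k le_kn; rewrite coefM; apply: eq_bigr => i _.
by rewrite fp ?gr // (leq_trans _ le_kn) ?leq_subr // -ltnS.
Qed.

Fact fps_mulA : associative fps_mul.
Proof.
move=> f g h; apply: fpsP => n.
have [[tf tg] th] := (@agree_trunc n f, @agree_trunc n g, @agree_trunc n h).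
rewrite (agree_mul tf (agree_mul tg th) (leqnn n)) mulrA.
by rewrite (agree_mul (agree_mul tf tg) th (leqnn n)).
Qed.

Fact fps_mulC : commutative fps_mul.
Proof.
move=> f g; apply: fpsP => n.
have [tf tg] := (@agree_trunc n f, @agree_trunc n g).
by rewrite (agree_mul tf tg (leqnn n)) mulrC (agree_mul tg tf (leqnn n)).
Qed.

Fact fps_mul1 : left_id fps_one fps_mul.
Proof.
move=> f; apply: fpsP => n /=.
by rewrite big_ord_recl big1 /= => [|i _]; rewrite ?mul0r // mul1r subn0 addr0.
Qed.

Fact fps_mulDl : left_distributive fps_mul fps_add.
Proof.
move=> f g h; apply: fpsP => n /=; rewrite -big_split.
by apply: eq_bigr => i _; rewrite mulrDl.
Qed.

Fact fps_one_neq0 : fps_one != 0.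
Proof.
by apply/eqP => /(congr1 (fun f => fps_coef f 0)) /eqP; rewrite /= oner_eq0.
Qed.

HB.instance Definition _ :=
  GRing.Zmodule_isComNzRing.Build (fps R) fps_mulA fps_mulC fps_mul1 fps_mulDl
    fps_one_neq0.

Lemma fps_coefM f g n : (f * g) n = \sum_(i < n.+1) f i * g (n - i)%N.
Proof. by []. Qed.

Lemma fps_coefM0 f g : (f * g) 0 = f 0 * g 0.
Proof. by rewrite fps_coefM big_ord1. Qed.


Lemma fps_coef0 n : (0 : fps R) n = 0. Proof. by []. Qed.
Lemma fps_coef1 n : (1 : fps R) n = (n == 0)%:R. Proof. by []. Qed.
Lemma fps_coefD f g n : (f + g) n = f n + g n. Proof. by []. Qed.
Lemma fps_coefN f n : (- f) n = - f n. Proof. by []. Qed.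

Definition fps_q : fps R := Fps (fun n => (n == 1)%:R).
Local Notation q := fps_q.

Lemma fps_coef_qM f n : (q * f) n = if n is m.+1 then f m else 0.
Proof.
rewrite fps_coefM; case: n => [|n]; first by rewrite big_ord1 mul0r.
rewrite 2!big_ord_recl big1 /= => [|i _]; last by rewrite mul0r.
by rewrite mul0r mul1r add0r addr0 subSS subn0.
Qed.

Lemma fps_coef_qXM k f n :
  (q ^+ k * f) n = if (n < k)%N then 0 else f (n - k)%N.
Proof.
elim: k n => [|k IH] n; first by rewrite mul1r subn0.
by rewrite exprS -mulrA fps_coef_qM; case: n => // n; rewrite IH.
Qed.

Lemma fps_qX_inj k f g : q ^+ k * f = q ^+ k * g -> f = g.
Proof.
move=> E; apply: fpsP => n.
have : (q ^+ k * f) (n + k)%N = (q ^+ k * g) (n + k)%N by rewrite E.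
by rewrite !fps_coef_qXM ltnNge leq_addl addnK.
Qed.


Definition eqmodq N f g := forall i, (i < N)%N -> f i = g i.

Lemma eqmodq_refl N f : eqmodq N f f. Proof. by []. Qed.

Lemma eqmodq_sym N f g : eqmodq N f g -> eqmodq N g f.
Proof. by move=> E i /E. Qed.

Lemma eqmodq_trans N f g h : eqmodq N f g -> eqmodq N g h -> eqmodq N f h.
Proof. by move=> E1 E2 i iN; rewrite E1 ?E2. Qed.

Lemma eqmodqP f g : (forall N, eqmodq N f g) -> f = g.
Proof. by move=> E; apply: fpsP => n; apply: (E n.+1). Qed.

Lemma eqmodqD N f f' g g' :
  eqmodq N f f' -> eqmodq N g g' -> eqmodq N (f + g) (f' + g').
Proof. by move=> E1 E2 i iN; rewrite !fps_coefD E1 ?E2. Qed.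

Lemma eqmodqM N f f' g g' :
  eqmodq N f f' -> eqmodq N g g' -> eqmodq N (f * g) (f' * g').
Proof.
move=> E1 E2 i iN; rewrite !fps_coefM; apply: eq_bigr => j _.
by rewrite E1 ?E2 // (leq_ltn_trans _ iN) ?leq_subr // -ltnS.
Qed.

Lemma eqmodqX N f g k : eqmodq N f g -> eqmodq N (f ^+ k) (g ^+ k).
Proof. by move=> E; elim: k => // k IH; rewrite !exprS; apply: eqmodqM. Qed.

Lemma eqmodq_sum N (I : Type) (r : seq I) (P : pred I) (F G : I -> fps R) :
  (forall i, P i -> eqmodq N (F i) (G i)) ->
  eqmodq N (\sum_(i <- r | P i) F i) (\sum_(i <- r | P i) G i).
Proof. by move=> E; apply: big_ind2 => //; apply: eqmodqD. Qed.

Lemma eqmodq_qXM N k f : (N <= k)%N -> eqmodq N (q ^+ k * f) 0.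
Proof. by move=> Nk i iN; rewrite fps_coef_qXM (leq_trans iN Nk). Qed.

Lemma eqmodq_mulI N f g h : f 0 = 1 -> eqmodq N (f * g) (f * h) -> eqmodq N g h.
Proof.
move=> f1 E n; elim/ltn_ind: n => n IH nN; have := E n nN.
rewrite !fps_coefM !big_ord_recl /= f1 !mul1r subn0 => /[dup].
rewrite (eq_bigr (fun i : 'I_n => f (lift ord0 i) * h (n - lift ord0 i)%N)).
  by move=> _ /addIr.
move=> i _; congr (_ * _); have := ltn_ord i; rewrite lift0 => ltin.
by apply: IH; rewrite /bump; lia.
Qed.

Lemma fps_mulI f g h : f 0 = 1 -> f * g = f * h -> g = h.
Proof.
by move=> f1 E; apply: eqmodqP => N; apply: (eqmodq_mulI f1); rewrite E.
Qed.

(* The limit of a sequence in which the [n]-th step only affects the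
   coefficients of order at least [n]. *)
Definition fps_lim (u : nat -> fps R) : fps R := Fps (fun n => u n.+1 n).

Lemma fps_limP (u : nat -> fps R) :
    (forall n, eqmodq n (u n.+1) (u n)) ->
  forall N n, (N <= n)%N -> eqmodq N (fps_lim u) (u n).
Proof.
move=> cvu N n Nn i iN /=; have {N iN Nn} lt_in := leq_trans iN Nn.
elim: n lt_in => // n IH; rewrite ltnS leq_eqVlt => /predU1P[-> //|lt_in].
by rewrite IH // cvu.
Qed.

Definition fps_prod (e : nat -> fps R) := fps_lim (fun n => \prod_(i < n) e i).
Definition fps_sum (e : nat -> fps R) := fps_lim (fun n => \sum_(i < n) e i).

Lemma fps_prodP (e : nat -> fps R) :
    (forall n, eqmodq n (e n) 1) ->
  forall N n, (N <= n)%N -> eqmodq N (fps_prod e) (\prod_(i < n) e i).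
Proof.
move=> e1; apply: fps_limP => n; rewrite big_ord_recr /=.
by rewrite -[X in eqmodq _ _ X]mulr1; apply: eqmodqM.
Qed.

Lemma fps_sumP (e : nat -> fps R) :
    (forall n, eqmodq n (e n) 0) ->
  forall N n, (N <= n)%N -> eqmodq N (fps_sum e) (\sum_(i < n) e i).
Proof.
move=> e1; apply: fps_limP => n; rewrite big_ord_recr /=.
by rewrite -[X in eqmodq _ _ X]addr0; apply: eqmodqD.
Qed.

Definition euler_factor i : fps R := if i == 0 then 1 else 1 - q ^+ i.

Lemma euler_factorP i : eqmodq i (euler_factor i) 1.
Proof.
rewrite /euler_factor; case: eqP => // _.
rewrite -[X in eqmodq _ _ X]subr0; apply: eqmodqD => // j ji.
by rewrite fps_coefN -[q ^+ i]mulr1 fps_coef_qXM ji.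
Qed.

Definition euler_prod (A : pred nat) :=
  fps_prod (fun i => if A i then euler_factor i else 1).

Lemma euler_prodP (A : pred nat) N n : (N <= n)%N ->
  eqmodq N (euler_prod A) (\prod_(i < n | A i) euler_factor i).
Proof.
rewrite big_mkcond; apply: fps_prodP => i.
by case: ifP => // _; apply: euler_factorP.
Qed.

Lemma euler_prod0 A : euler_prod A 0 = 1.
Proof.
by rewrite (euler_prodP A (leqnn 1)) // big_mkcond big_ord1; case: ifP.
Qed.

Lemma euler_prod_count (s t : seq (pred nat)) :
    (forall i, (0 < i)%N ->
       count (fun A : pred nat => A i) s = count (fun A : pred nat => A i) t) ->
  \prod_(A <- s) euler_prod A = \prod_(A <- t) euler_prod A.
Proof.
have H (N : nat) (u : seq (pred nat)) : eqmodq N (\prod_(A <- u) euler_prod A)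
    (\prod_(i < N) euler_factor i ^+ count (fun A : pred nat => A i) u).
  elim: u => [|A u IH]; first by rewrite big_nil big1.
  rewrite big_cons.
  apply: eqmodq_trans (eqmodqM (euler_prodP A (leqnn N)) IH) _.
  rewrite [X in X * _]big_mkcond -big_split /=.
  rewrite (eq_bigr (fun i : 'I_N =>
    euler_factor i ^+ (A i + count (fun A : pred nat => A i) u))) //.
  by move=> i _; rewrite exprD; case: (A i).
move=> E; apply: eqmodqP => N; apply: eqmodq_trans (H N s) _.
apply: eqmodq_trans _ (eqmodq_sym (H N t)).
rewrite (eq_bigr (fun i : 'I_N =>
  euler_factor i ^+ count (fun A : pred nat => A i) t)) // => i _.
by case: (posnP i) => [->|/E -> //]; rewrite !expr1n.
Qed.

Definition residue d r : pred nat := fun i => (i %% d)%N == r.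

Lemma euler_prod_residue d r N n : (r < d)%N -> (N <= n)%N ->
  eqmodq N (euler_prod (residue d r))
           (\prod_(j < n) euler_factor (j * d + r)%N).
Proof.
move=> rd Nn; have d0 : (0 < d)%N by apply: leq_ltn_trans rd.
suff -> : \prod_(j < n) euler_factor (j * d + r)%N =
          \prod_(i < n * d | residue d r i) euler_factor i.
  by apply: euler_prodP; apply: leq_trans Nn (leq_pmulr _ d0).
rewrite -(big_mkord (residue d r)) [RHS]big_mkcond big_nat_mul.
rewrite -(big_mkord xpredT (fun j => euler_factor (j * d + r)%N)).
apply: eq_bigr => j _.
rewrite -{2}[(j * d)%N]add0n big_addn mulSn addnK big_mkord.
rewrite (bigD1 (Ordinal rd)) //= /residue [(r + _)%N]addnC modnMDl.
rewrite modn_small // eqxx.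
rewrite big1 ?mulr1 // => i; rewrite -val_eqE /= => /negPf ir.
by rewrite addnC modnMDl modn_small // ir.
Qed.

End FormalPowerSeries.

Section GaussianBinomials.
Variables (R : comNzRingType) (Q : R).

Fixpoint qbin (m j : nat) : R :=
  match m, j with
  | _, 0 => 1
  | 0, _.+1 => 0
  | m'.+1, j'.+1 => qbin m' j'.+1 + Q ^+ (m' - j') * qbin m' j'
  end.

Definition qfact (m : nat) : R := \prod_(i < m) (1 - Q ^+ i.+1).

Lemma qbin0 m : qbin m 0 = 1. Proof. by case: m. Qed.

Lemma qbinS m j : qbin m.+1 j.+1 = qbin m j.+1 + Q ^+ (m - j) * qbin m j.
Proof. by []. Qed.

Lemma qbin_small m j : (m < j)%N -> qbin m j = 0.
Proof.
elim: m j => [|m IH] [|j] // mj.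
by rewrite qbinS !IH ?mulr0 ?addr0 // ltnW.
Qed.

Lemma qbin_diag m : qbin m m = 1.
Proof.
by elim: m => // m IH; rewrite qbinS qbin_small // IH subnn mulr1 add0r.
Qed.

Lemma qfactS m : qfact m.+1 = qfact m * (1 - Q ^+ m.+1).
Proof. by rewrite /qfact big_ord_recr. Qed.

Lemma qbin_fact j l : qbin (j + l) j * (qfact j * qfact l) = qfact (j + l).
Proof.
elim: j l => [|j IHj] l.
  by rewrite qbin0 {1}/qfact big_ord0 !mul1r.
elim: l => [|l IHl].
  by rewrite addn0 qbin_diag {2}/qfact big_ord0 mulr1 mul1r.
have := IHj l.+1; move: IHl.
rewrite !addSn !addnS => IHl IHj'.
rewrite qbinS (_ : (j + l).+1 - j = l.+1)%N; last by lia.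
move: IHl IHj'; rewrite !qfactS.
set B1 := qbin _ j.+1; set B2 := qbin _ j; set F := qfact (j + l) => E1 E2.
have -> : Q ^+ (j + l).+2 = Q ^+ j.+1 * Q ^+ l.+1 by rewrite -exprD addSn addnS.
rewrite mulrDl.
transitivity (B1 * (qfact j * (1 - Q ^+ j.+1) * qfact l) * (1 - Q ^+ l.+1) +
  Q ^+ l.+1 * (1 - Q ^+ j.+1) * (B2 * (qfact j * (qfact l * (1 - Q ^+ l.+1))))).
  by ring.
rewrite E1 E2; ring.
Qed.

Lemma qbinomial_thm (x y : R) m :
  \prod_(i < m) (x + y * Q ^+ i) =
  \sum_(j < m.+1) qbin m j * Q ^+ 'C(j, 2) * y ^+ j * x ^+ (m - j).
Proof.
elim: m => [|m IH]; first by rewrite big_ord0 big_ord1 !mulr1.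
rewrite big_ord_recr /= IH mulrDr !mulr_suml.
pose T j := qbin m j * Q ^+ 'C(j, 2) * y ^+ j * x ^+ (m - j).
have -> : \sum_(j < m.+1) T j * x = \sum_(j < m.+2) T j * x.
  by rewrite [RHS]big_ord_recr /= [T m.+1]/T qbin_small // !mul0r addr0.
rewrite [X in X + _]big_ord_recl [RHS]big_ord_recl /= -addrA; congr (_ + _).
  by rewrite /T !qbin0 !subn0 -mulrA -exprSr.
rewrite -big_split /T /=.
apply: eq_bigr => -[j /= jm] _; rewrite /bump add1n !add0n subSS.
rewrite !mulrDl; congr (_ + _).
  move: jm; rewrite ltnS leq_eqVlt => /predU1P[->|jm].
    by rewrite qbin_small // !mul0r.
  by rewrite (_ : m - j = (m - j.+1).+1)%N ?exprSr ?mulrA; last by lia.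
have -> : Q ^+ m = Q ^+ (m - j) * Q ^+ j by rewrite -exprD subnK.
by rewrite binS bin1 exprD exprS; ring.
Qed.

End GaussianBinomials.

Lemma bin2D n k : 'C(n + k, 2) = ('C(n, 2) + 'C(k, 2) + n * k)%N.
Proof.
elim: n => [|n IH]; first by rewrite mul0n addn0.
by rewrite addSn !binS !bin1 IH; lia.
Qed.

Lemma double_bin2 n : ('C(n, 2) + 'C(n, 2) + n = n * n)%N.
Proof. by elim: n => // n IH; rewrite binS bin1; lia. Qed.

Section FiniteTripleProduct.
Variables (R : comNzRingType) (a b : R).
Let Q := a * b.

Definition theta_term (x y : R) k := x ^+ 'C(k.+1, 2) * y ^+ 'C(k, 2).

(* The binomial theorem for the [2n] factors [Q^n + a Q^i]; dividing by the
   monomial would give the usual finite form of the triple product. *)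
Lemma finite_triple_product n :
  a ^+ n * Q ^+ (n * n + 'C(n, 2)) *
    \prod_(i < n) ((1 + a * Q ^+ i) * (1 + b * Q ^+ i)) =
  a ^+ n * Q ^+ (n * n + 'C(n, 2)) *
    (\sum_(l < n) qbin Q (n + n) (n - l.+1) * theta_term b a l.+1 +
     \sum_(k < n.+1) qbin Q (n + n) (n + k) * theta_term a b k).
Proof.
transitivity (\prod_(i < n + n) (Q ^+ n + a * Q ^+ i)).
  rewrite big_split_ord /= big_split /=.
  have -> : \prod_(i < n) (Q ^+ n + a * Q ^+ i) =
            a ^+ n * Q ^+ 'C(n, 2) * \prod_(i < n) (1 + b * Q ^+ i).
    rewrite -bin2_sum big_mkord -prodrXr.
    rewrite -[in a ^+ n](card_ord n) -prodr_const.
    rewrite -big_split /= [X in _ = _ * X](reindex_inj rev_ord_inj).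
    rewrite -big_split /=.
    apply: eq_bigr => i _; rewrite mulrDr mulr1 addrC; congr (_ + _).
    have -> : a * Q ^+ i * (b * Q ^+ (n - i.+1)) =
              Q * (Q ^+ i * Q ^+ (n - i.+1)).
      by rewrite /Q; ring.
    by rewrite -exprD -exprS; congr (_ ^+ _); have := ltn_ord i; lia.
  have -> : \prod_(i < n) (Q ^+ n + a * Q ^+ (n + i)) =
            Q ^+ (n * n) * \prod_(i < n) (1 + a * Q ^+ i).
    rewrite exprM -[X in _ ^+ n ^+ X]card_ord -prodr_const -big_split /=.
    by apply: eq_bigr => i _; rewrite exprD; ring.
  rewrite exprD; ring.
rewrite qbinomial_thm -addnS big_split_ord /= mulrDr !mulr_sumr; congr (_ + _).
  rewrite (reindex_inj rev_ord_inj); apply: eq_bigr => i _ /=.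
  have := ltn_ord i; set l := i.+1 => ln; set m := (n - l)%N.
  have En : n = (m + l)%N by rewrite /m subnK.
  rewrite [RHS]mulrCA -!mulrA; congr (_ * _).
  rewrite /theta_term binS bin1 /Q -exprM !exprMn.
  have -> : (n + n - m = n + l)%N by lia.
  clearbody m; rewrite En bin2D.
  rewrite [LHS](_ : _ = a ^+ ('C(m, 2) + m + (m + l) * (m + l + l)) *
                        b ^+ ('C(m, 2) + (m + l) * (m + l + l))); last first.
    by rewrite !exprD; ring.
  rewrite [RHS](_ : _ =
      a ^+ ((m + l) + ((m + l) * (m + l) + ('C(m, 2) + 'C(l, 2) + m * l)) +
            'C(l, 2)) *
      b ^+ (((m + l) * (m + l) + ('C(m, 2) + 'C(l, 2) + m * l)) +
            ('C(l, 2) + l))); last first.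
    by rewrite !exprD; ring.
  have D := double_bin2 l; congr (_ ^+ _ * _ ^+ _); nia.
apply: eq_bigr => i _; have := ltn_ord i; set k : nat := i; rewrite ltnS => kn.
set m := (n - k)%N; have En : n = (m + k)%N by rewrite /m subnK.
rewrite [RHS]mulrCA -!mulrA; congr (_ * _).
rewrite /theta_term binS bin1 /Q -exprM !exprMn.
have -> : (n + n - (n + k) = m)%N by lia.
clearbody m; rewrite En !bin2D.
rewrite [LHS](_ : _ =
    a ^+ ('C(m, 2) + 'C(k, 2) + m * k + 'C(k, 2) + (m + k) * k +
          (m + k + k) + (m + k) * m) *
    b ^+ ('C(m, 2) + 'C(k, 2) + m * k + 'C(k, 2) + (m + k) * k +
          (m + k) * m)); last first.
  by rewrite !exprD; ring.
rewrite [RHS](_ : _ =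
    a ^+ ((m + k) + ((m + k) * (m + k) + ('C(m, 2) + 'C(k, 2) + m * k)) +
          ('C(k, 2) + k)) *
    b ^+ (((m + k) * (m + k) + ('C(m, 2) + 'C(k, 2) + m * k)) + 'C(k, 2)));
  last first.
  by rewrite !exprD; ring.
by congr (_ ^+ _ * _ ^+ _); nia.
Qed.

End FiniteTripleProduct.

Section TripleProduct.
Variable R : comNzRingType.
Local Notation q := (fps_q R).

Definition theta (a b : fps R) : fps R :=
  fps_sum (fun k => if k == 0 then 1 else theta_term a b k + theta_term b a k).

Lemma theta_term_qXE i j k : theta_term (- q ^+ i) (- q ^+ j) k =
  (-1) ^+ k * q ^+ (i * 'C(k.+1, 2) + j * 'C(k, 2)).
Proof.
rewrite /theta_term (exprNn (q ^+ i)) (exprNn (q ^+ j)) -!exprM mulrACA -!exprD.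
congr (_ * _); rewrite binS bin1 addnAC addnn -mul2n exprD exprM sqrrN.
by rewrite !expr1n mul1r.
Qed.

Lemma theta_term_qX i j k N : (0 < i)%N -> (0 < j)%N -> (N <= k)%N ->
  eqmodq N (theta_term (- q ^+ i) (- q ^+ j) k) 0.
Proof.
move=> i0 j0 Nk; rewrite theta_term_qXE mulrC.
apply/eqmodq_qXM/(leq_trans Nk); have := double_bin2 k.
by rewrite binS bin1; nia.
Qed.

Lemma eqmodq_theta i j N n : (0 < i)%N -> (0 < j)%N -> (N <= n)%N ->
  eqmodq N (theta (- q ^+ i) (- q ^+ j))
    (\sum_(k < n) if k == 0 :> nat then 1 else
       theta_term (- q ^+ i) (- q ^+ j) k + theta_term (- q ^+ j) (- q ^+ i) k).
Proof.
move=> i0 j0; apply: fps_sumP => -[|k] //; rewrite -[X in eqmodq _ _ X]addr0.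
by apply: eqmodqD; apply: theta_term_qX.
Qed.

Lemma qfact_residue d N n : (0 < d)%N -> (N <= n)%N ->
  eqmodq N (euler_prod R (residue d 0)) (qfact (q ^+ d) n).
Proof.
move=> d0 Nn; apply: eqmodq_trans (euler_prod_residue R d0 (leqW Nn)) _.
rewrite big_ord_recl mul0n addn0 mul1r.
rewrite (eq_bigr (fun i : 'I_n => 1 - q ^+ d ^+ i.+1)) //.
move=> i _; rewrite lift0 addn0 -exprM mulnC /euler_factor.
by rewrite -[d]prednK.
Qed.

Lemma qbin_limit d N j l : (0 < d)%N -> (N <= j)%N -> (N <= l)%N ->
  eqmodq N (qbin (q ^+ d) (j + l) j * euler_prod R (residue d 0)) 1.
Proof.
move=> d0 Nj Nl; set E := euler_prod R _.
have E0 : E 0 = 1 by apply: euler_prod0.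
apply: (eqmodq_mulI E0); rewrite mulr1.
rewrite mulrCA.
apply: eqmodq_trans (eqmodqM (@eqmodq_refl _ _ _) (eqmodqM _ _)) _.
- exact: qfact_residue Nj.
- exact: qfact_residue Nl.
rewrite qbin_fact; apply/eqmodq_sym/qfact_residue => //.
exact: leq_trans Nj (leq_addr _ _).
Qed.

Lemma jacobi_triple_product i j : (0 < i)%N -> (0 < j)%N ->
  theta (- q ^+ i) (- q ^+ j) =
  euler_prod R (residue (i + j) i) * euler_prod R (residue (i + j) j) *
  euler_prod R (residue (i + j) 0).
Proof.
move=> i0 j0; set a := - q ^+ i; set b := - q ^+ j; pose Q := a * b.
have QE : Q = q ^+ (i + j) by rewrite /Q mulrNN exprD.
set E := euler_prod R (residue _ 0).
apply: eqmodqP => N; pose n := (N + N)%N.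
have Nn : (N <= n)%N by exact: leq_addr.
apply: eqmodq_trans (eqmodq_theta i0 j0 (leqW Nn)) _; apply: eqmodq_sym.
have ha : eqmodq N (euler_prod R (residue (i + j) i))
    (\prod_(k < n) (1 + a * Q ^+ k)).
  apply: eqmodq_trans (euler_prod_residue R _ Nn) _; first by lia.
  rewrite (eq_bigr (fun k : 'I_n => 1 + a * Q ^+ k)) // => k _.
  rewrite /euler_factor QE -exprM mulNr -exprD mulnC addnC.
  by rewrite addn_eq0 (gtn_eqF i0).
have hb : eqmodq N (euler_prod R (residue (i + j) j))
    (\prod_(k < n) (1 + b * Q ^+ k)).
  apply: eqmodq_trans (euler_prod_residue R _ Nn) _; first by lia.
  rewrite (eq_bigr (fun k : 'I_n => 1 + b * Q ^+ k)) // => k _.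
  rewrite /euler_factor QE -exprM mulNr -exprD mulnC addnC.
  by rewrite addn_eq0 (gtn_eqF j0).
apply: eqmodq_trans (eqmodqM (eqmodqM ha hb) (@eqmodq_refl _ _ _)) _.
have := finite_triple_product a b n; rewrite -/Q big_split /=.
have -> : a ^+ n * Q ^+ (n * n + 'C(n, 2)) =
    (-1) ^+ n * q ^+ (i * n + (i + j) * (n * n + 'C(n, 2))).
  by rewrite QE /a (exprNn (q ^+ i)) -!exprM -mulrA -exprD.
rewrite -!mulrA => /(congr1 ( *%R ((-1) ^+ n))); rewrite !signrMK.
move=> /fps_qX_inj fin; rewrite mulrA fin mulrDl !mulr_suml addrC.
have qbinE k : (k <= N)%N -> eqmodq N (qbin Q (n + n) (n - k) * E) 1 /\
    eqmodq N (qbin Q (n + n) (n + k) * E) 1.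
  move=> kN; rewrite QE; split.
    rewrite (_ : n + n = (n - k) + (n + k))%N; last by rewrite /n; lia.
    by apply: qbin_limit; rewrite /n; lia.
  rewrite [X in qbin _ X](_ : _ = (n + k) + (n - k))%N; last by rewrite /n; lia.
  by apply: qbin_limit; rewrite /n; lia.
have termE x y k Z : (forall m, (N <= m)%N -> eqmodq N (theta_term x y m) 0) ->
    ((k <= N)%N -> eqmodq N (Z * E) 1) ->
    eqmodq N (Z * theta_term x y k * E) (theta_term x y k).
  move=> xy0 Z1; rewrite mulrAC; case: (leqP k N) => [/Z1 ZE|/ltnW /xy0 t0].
    by rewrite -[X in eqmodq _ _ X]mul1r; apply: eqmodqM.
  apply: eqmodq_trans (eqmodq_sym t0).
  rewrite -[X in eqmodq _ _ X](mulr0 (Z * E)).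
  exact: eqmodqM.
rewrite [X in X + _]big_ord_recl [X in eqmodq _ _ X]big_ord_recl /= -addrA.
apply: eqmodqD.
  have t0 : theta_term a b 0 = 1 by exact: mulr1.
  rewrite -[X in eqmodq _ _ X]t0; apply: termE.
  - by move=> m; apply: theta_term_qX.
  - by move=> _; apply: (qbinE 0 _).2.
rewrite -big_split; apply: eqmodq_sum => k _ /=; apply: eqmodqD.
  apply: termE => [m|kN]; first exact: theta_term_qX.
  exact: (qbinE _ _).2.
apply: termE => [m|kN]; first exact: theta_term_qX.
exact: (qbinE _ _).1.
Qed.

End TripleProduct.

Section GeneratingFunction.
Local Open Scope nat_scope.

Definition dp_list n : seq (seq nat) := projT1 (cid (dp_count n)).

Lemma dp_list_uniq n : uniq (dp_list n).
Proof. by rewrite /dp_list; case: cid => l /= []. Qed.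

Lemma mem_dp_list n s : (s \in dp_list n) = is_dp_partition n s.
Proof. by rewrite /dp_list; case: cid => l /= [_ lP _]; apply: lP. Qed.

Lemma size_dp_list n : size (dp_list n) = dp n.
Proof. by rewrite /dp_list; case: cid => l /= []. Qed.

Definition dp_list_le m n := [seq s <- dp_list n | all (geq m) s].

Lemma mem_dp_list_le m n s :
  (s \in dp_list_le m n) = all (geq m) s && is_dp_partition n s.
Proof. by rewrite mem_filter mem_dp_list. Qed.

Lemma size_dp_list_le m n : n <= m -> size (dp_list_le m n) = dp n.
Proof.
move=> nm; rewrite -size_dp_list; congr size; apply/all_filterP/allP => s.
rewrite mem_dp_list => /andP[/and3P[_ _ /eqP sn] _].
by apply/allP => x /mem_le_sumn; rewrite sn => xn; apply: leq_trans nm.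
Qed.

Lemma is_dp_partition_cons m n s : 0 < m ->
  all (geq m) (m :: s) && is_dp_partition n (m :: s) =
  [&& dp_part m, m <= n & all (geq m) s && is_dp_partition (n - m) s].
Proof.
move=> m0; rewrite /is_dp_partition /is_partition /= leqnn m0 /=.
have -> : path geq m s = all (geq m) s && sorted geq s.
  by rewrite path_sortedE // => x y z xy yz; apply: leq_trans yz xy.
have -> : (m + sumn s == n) = (m <= n) && (sumn s == n - m).
  by apply/eqP/andP => [<-|[mn /eqP ->]]; rewrite ?leq_addr ?addKn ?subnKC.
by case: (all _ _); case: (sorted _ _); case: (all _ _); case: (_ <= _);
  case: (_ == _); case: (dp_part _); rewrite /= ?andbF.
Qed.

Lemma size_dp_list_leS m n :
  size (dp_list_le m.+1 n) =
  size (dp_list_le m n) +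
  (if dp_part m.+1 && (m.+1 <= n) then size (dp_list_le m.+1 (n - m.+1))
   else 0).
Proof.
pose l := if dp_part m.+1 && (m.+1 <= n) then
  [seq m.+1 :: s | s <- dp_list_le m.+1 (n - m.+1)] else [::].
have lP s : (s \in l) =
    (head 0 s == m.+1) && (all (geq m.+1) s && is_dp_partition n s).
  case: s => [|x s].
    rewrite /l; case: ifP => // _; apply/mapP; case=> ? _ //.
  have [->|xm] := eqVneq x m.+1; last first.
    rewrite /l; case: ifP => // _; apply/mapP; case=> t _ [E _].
    by rewrite E eqxx in xm.
  rewrite andTb is_dp_partition_cons // /l.
  case: (dp_part _) => //=; case: (_ <= _) => //=.
  by rewrite mem_map ?mem_dp_list_le // => t u [].
have -> : (if dp_part m.+1 && (m.+1 <= n) then size (dp_list_le m.+1 (n - m.+1))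
           else 0) = size l.
  by rewrite /l; case: ifP; rewrite ?size_map.
rewrite -size_cat; apply/perm_size/uniq_perm.
- exact/filter_uniq/dp_list_uniq.
- rewrite cat_uniq filter_uniq ?dp_list_uniq //=; apply/andP; split.
    apply/hasPn => s; rewrite lP mem_dp_list_le => /andP[/eqP sm _].
    by case: s sm => [|x s] //= ->; rewrite ltnn.
  rewrite /l; case: ifP => // _; rewrite map_inj_uniq => [|t u []//].
  exact/filter_uniq/dp_list_uniq.
move=> s; rewrite mem_cat lP !mem_dp_list_le.
case: (boolP (is_dp_partition n s));
  last by rewrite !andbF.
rewrite !andbT => /andP[/and3P[+ _ _] _]; case: s => [|x s] //= xs.
have sx : all (geq x) s.
  by apply: order_path_min xs => a b c ab bc; apply: leq_trans bc ab.
rewrite leq_eqVlt ltnS; case: eqVneq => [->|_] /=.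
  by rewrite ltnn.
rewrite orbF; case: (leqP x m) => //= xm; rewrite [RHS](_ : _ = true).
  by apply/allP => y /(allP sx) yx; apply: leq_trans yx (leqW xm).
by apply/allP => y /(allP sx) yx; apply: leq_trans yx xm.
Qed.

End GeneratingFunction.

Definition dp_series (R : comNzRingType) : fps R := Fps (fun n => (dp n)%:R).

Lemma dp_seriesE (R : comNzRingType) : dp_series R * euler_prod R dp_part = 1.
Proof.
pose C m : fps R := Fps (fun n => (size (dp_list_le m n))%:R).
have CE m : C m * \prod_(i < m.+1 | dp_part i) euler_factor R i = 1.
  elim: m => [|m IH].
    rewrite big_mkcond big_ord1 /= mulr1; apply: fpsP => -[|n] /=.
      rewrite size_dp_list_le // (_ : dp 0 = 1)%N // -(size_dp_list 0).
      suff /perm_size -> : perm_eq (dp_list 0) [:: [::]] by [].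
      apply: uniq_perm => // [|s]; first exact: dp_list_uniq.
      rewrite mem_dp_list inE; case: s => //= x s; apply/negP => /andP[].
      by case/and3P => _ /= /andP[x0 _]; case: x x0.
    rewrite (_ : dp_list_le 0 n.+1 = [::]) //; apply/nilP.
    rewrite /nilp -leqn0 leqNgt -has_predT; apply/hasPn => s.
    rewrite mem_dp_list_le; case: s => [|x s] //.
    by case/and3P=> /andP[/= x0 _] /and3P[_ /= /andP[]]; case: x x0.
  rewrite big_mkcond big_ord_recr /= -big_mkcond /= mulrA mulrAC.
  suff -> : C m.+1 * (if dp_part m.+1 then euler_factor R m.+1 else 1) = C m.
    by [].
  case: ifP => hm; last first.
    rewrite mulr1; apply: fpsP => n /=.
    by rewrite size_dp_list_leS hm addn0.
  rewrite /euler_factor /= mulrBr mulr1 mulrC; apply: fpsP => n.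
  rewrite fps_coefD fps_coefN fps_coef_qXM /= size_dp_list_leS hm /= leqNgt.
  by case: (ltnP n m.+1) => _; rewrite ?subr0 ?addn0 //= natrD addrK.
apply: eqmodqP => N; rewrite -(CE N); apply: eqmodqM.
  by move=> i iN /=; rewrite size_dp_list_le // ltnW.
by apply: euler_prodP.
Qed.

Section Modulo3.
Local Notation F3 := 'F_3.
Local Notation q := (fps_q F3).
Local Notation E d := (euler_prod F3 (residue d 0)).
Implicit Types f g : fps F3.

Lemma fps_mulr3n f : f *+ 3 = 0.
Proof.
by apply: fpsP => n; apply: (mulrn_pchar (pchar_Fp (isT : prime 3)) (f n)).
Qed.

Lemma fps_double f : f + f = - f.
Proof. by apply/eqP; rewrite -subr_eq0 opprK -addrA; apply/eqP/fps_mulr3n. Qed.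

Lemma fps_cubeD f g : (f + g) ^+ 3 = f ^+ 3 + g ^+ 3.
Proof.
rewrite [LHS](_ : _ = f ^+ 3 + g ^+ 3 +
  (f ^+ 2 * g + f * g ^+ 2) *+ 3); last by ring.
by rewrite fps_mulr3n addr0.
Qed.

Lemma fps_exp9D f g : (f + g) ^+ 9 = f ^+ 9 + g ^+ 9.
Proof. by rewrite -[9%N]/(3 * 3)%N !exprM !fps_cubeD. Qed.

Lemma F3_cube (x : F3) : x ^+ 3 = x.
Proof. by case: x => [[|[|[|]]]] // ?; apply/val_inj. Qed.

Definition fps_const (c : F3) : fps F3 :=
  Fps (fun n => if n == 0 then c else 0).

Lemma fps_coef_constM c f n : (fps_const c * f) n = c * f n.
Proof.
by rewrite fps_coefM big_ord_recl subn0 big1 ?addr0 // => i _; rewrite mul0r.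
Qed.

Lemma fps_const_cube c : fps_const c ^+ 3 = fps_const c.
Proof.
apply: fpsP => n; rewrite !exprS mulr1 !fps_coef_constM /=.
by case: eqP; rewrite ?mulr0 // -!expr2 -!exprS F3_cube.
Qed.

Lemma fps_split0 f : f = fps_const (f 0) + q * Fps (fun n => f n.+1).
Proof.
apply: fpsP => -[|n]; rewrite fps_coefD fps_coef_qM /= ?addr0 //.
by rewrite add0r.
Qed.

Definition dissect r f : fps F3 := Fps (fun n => f (3 * n + r)%N).

Lemma dissectD r f g : dissect r (f + g) = dissect r f + dissect r g.
Proof. exact: fpsP. Qed.

(* In characteristic 3, [f ^+ 3] is [f] evaluated at [q ^+ 3]. *)
Lemma dissect_cubeM r f g : (r < 3)%N ->
  dissect r (f ^+ 3 * g) = f * dissect r g.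
Proof.
move=> r3; apply: fpsP => n.
change ((f ^+ 3 * g) (3 * n + r)%N = (f * dissect r g) n).
elim: n f => [|n IH] f; rewrite {1}[f]fps_split0 [in RHS](fps_split0 f);
  set f' := Fps _; rewrite fps_cubeD fps_const_cube exprMn !mulrDl;
  rewrite -(mulrA (q ^+ 3)) -(mulrA q);
  rewrite !fps_coefD !fps_coef_constM fps_coef_qXM fps_coef_qM;
  congr (_ + _).
  by rewrite muln0 add0n r3.
rewrite -IH ltnNge (_ : (3 <= 3 * n.+1 + r)%N); last by lia.
by congr (fps_coef _ _); lia.
Qed.

Lemma dissect_qX r s : (r < 3)%N -> (s < 3)%N ->
  dissect r (q ^+ s) = (r == s)%:R.
Proof.
move=> r3 s3; apply: fpsP => n /=; rewrite -[q ^+ s]mulr1 fps_coef_qXM fps_coef1.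
case: (r =P s) => [->|rs]; rewrite ?fps_coef1 ?fps_coef0.
  by rewrite addnK muln_eq0 ltnNge leq_addl.
by case: ltnP => // h; rewrite gtn_eqF //; lia.
Qed.

Lemma dissect_cube r s f : (r < 3)%N -> (s < 3)%N ->
  dissect r (f ^+ 3 * q ^+ s) = f *+ (r == s).
Proof. by move=> r3 s3; rewrite dissect_cubeM // dissect_qX // mulr_natr. Qed.

Lemma euler_cube d : (0 < d)%N -> E (3 * d) = E d ^+ 3.
Proof.
move=> d0; apply: eqmodqP => N.
apply: eqmodq_trans (euler_prod_residue F3 _ (leqnn N)) _; first by lia.
apply: eqmodq_sym.
apply: eqmodq_trans (eqmodqX 3 (euler_prod_residue F3 d0 (leqnn N))) _.
rewrite -prodrXl.
rewrite (eq_bigr (fun j : 'I_N => euler_factor F3 (j * (3 * d) + 0)%N)) // => j _.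
rewrite !addn0 /euler_factor mulnCA (muln_eq0 3) orFb.
case: eqP => _; first exact: expr1n.
rewrite fps_cubeD expr1n [(3 * _)%N]mulnC [in RHS]exprM; congr (_ + _).
by ring.
Qed.

Definition phi d : fps F3 := theta (- q ^+ d) (- q ^+ d).
Definition omega d : fps F3 := theta (- q ^+ d) (- q ^+ (5 * d)).

Lemma phi_dissection d : (0 < d)%N ->
  phi d = phi d ^+ 9 + q ^+ d * omega d ^+ 3.
Proof.
move=> d0; have d5 : (0 < 5 * d)%N by rewrite muln_gt0.
pose s k : fps F3 := (-1) ^+ k.
have ss k : s k ^+ 2 = 1 by rewrite -exprM mulnC exprM sqrrN !expr1n.
pose u k := if k == 0 then 1 else - (s k * q ^+ (d * (k * k))).
pose v k := if k == 0 then 1 else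
  s k * (q ^+ (d * (3 * (k * k) - 2 * k)) + q ^+ (d * (3 * (k * k) + 2 * k))).
have hu N n : (N <= n)%N -> eqmodq N (phi d) (\sum_(k < n) u k).
  move=> Nn; apply: eqmodq_trans (eqmodq_theta F3 d0 d0 Nn) _.
  apply: eqmodq_sum => k _; rewrite /u; case: eqP => // _.
  rewrite theta_term_qXE -/(s k) fps_double -mulnDr (_ : _ + _ = k * k)%N //.
  by have := double_bin2 k; rewrite binS bin1; lia.
have hv N n : (N <= n)%N -> eqmodq N (omega d) (\sum_(k < n) v k).
  move=> Nn; apply: eqmodq_trans (eqmodq_theta F3 d0 d5 Nn) _.
  apply: eqmodq_sum => k _; rewrite /v; case: eqP => // _.
  rewrite !theta_term_qXE -mulrDr -/(s k); have := double_bin2 k.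
  rewrite binS bin1 => D; rewrite [X in eqmodq _ X](_ : _ =
    s k * (q ^+ (d * (3 * (k * k) - 2 * k)) +
           q ^+ (d * (3 * (k * k) + 2 * k)))) //.
  by congr (_ * (q ^+ _ + q ^+ _)); nia.
have fin n : \sum_(k < 3 * n + 2) u k =
    (\sum_(k < n.+1) u k) ^+ 9 + q ^+ d * (\sum_(k < n.+1) v k) ^+ 3.
  elim: n => [|n IH].
    rewrite !big_ord_recr !big_ord0 /u /v /s /= !add0r !expr1n mulr1 !muln1.
    by rewrite expr1 mulN1r opprK.
  rewrite (_ : 3 * n.+1 + 2 = (3 * n + 2).+3)%N; last by lia.
  rewrite 3!big_ord_recr /= IH [X in _ = X ^+ 9 + _]big_ord_recr.
  rewrite [X in _ = _ + _ * X ^+ 3]big_ord_recr /=.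
  rewrite fps_exp9D fps_cubeD.
  suff E3 : u (3 * n + 2)%N + (u (3 * n + 2).+1 + u (3 * n + 2).+2) =
            u n.+1 ^+ 9 + q ^+ d * v n.+1 ^+ 3.
    by rewrite -!addrA E3; ring.
  have sE k : s k.+1 = - s k by rewrite /s exprS mulN1r.
  have sn : s (3 * n)%N = s n by rewrite /s mulnC exprM -/(s n) exprS ss mulr1.
  rewrite /u /v !addn2 /= !sE !opprK sn -/(s n).
  set x := s n.
  have x3 : x ^+ 3 = x by rewrite exprS ss mulr1.
  rewrite mulNr opprK [RHS](_ : _ = x ^+ 9 * q ^+ (d * (n.+1 * n.+1)) ^+ 9 -
    q ^+ d * x ^+ 3 * (q ^+ (d * (3 * (n.+1 * n.+1) - 2 * n.+1)) +
                      q ^+ (d * (3 * (n.+1 * n.+1) + 2 * n.+1))) ^+ 3).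
    rewrite -[9%N]/(3 * 3)%N (exprM x) x3 x3 fps_cubeD -!exprM.
    rewrite [X in x * X - _](_ : _ = q ^+ (d * ((3 * n).+3 * (3 * n).+3))).
      rewrite (_ : d * ((3 * n).+2 * (3 * n).+2) =
        d + d * (3 * (n.+1 * n.+1) - 2 * n.+1) * 3)%N; last by nia.
      rewrite (_ : d * ((3 * n).+4 * (3 * n).+4) =
        d + d * (3 * (n.+1 * n.+1) + 2 * n.+1) * 3)%N; last by nia.
      rewrite !(exprD q d); ring.
    by congr (_ ^+ _); nia.
  by rewrite mulNr opprK; ring.
apply: eqmodqP => N; apply: eqmodq_trans (hu _ (3 * N + 2)%N _) _; first by lia.
rewrite fin; apply: eqmodqD; first exact/eqmodqX/eqmodq_sym/hu/leqnSn.
apply: eqmodqM => //; exact/eqmodqX/eqmodq_sym/hv/leqnSn.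
Qed.

Lemma phi_product d : (0 < d)%N -> phi d * E (2 * d) = E d ^+ 2.
Proof.
move=> d0; rewrite /phi jacobi_triple_product // addnn -mul2n.
have := @euler_prod_count F3
  [:: residue (2 * d) d; residue (2 * d) d;
      residue (2 * d) 0; residue (2 * d) 0]
  [:: residue d 0; residue d 0].
rewrite !big_cons !big_nil !mulr1 -!mulrA => -> //.
move=> i _; rewrite /residue /= !addn0.
have /ltn_pmod rd : (0 < 2 * d)%N by rewrite muln_gt0.
rewrite -(@modn_dvdm (2 * d) i d) ?dvdn_mull //.
move: (rd i); move: (i %% _)%N => r rd2.
case: (ltnP r d) => [rd1|/subnK <-] in rd2 *.
  by rewrite modn_small // (ltn_eqF rd1); lia.
by rewrite modnDr modn_small; lia.
Qed.

Lemma omega_product : omega 1 * E 2 * E 3 = E 1 * E 6 ^+ 2.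
Proof.
rewrite /omega jacobi_triple_product //.
have := @euler_prod_count F3
  [:: residue 6 1; residue 6 5; residue 6 0; residue 2 0; residue 3 0]
  [:: residue 1 0; residue 6 0; residue 6 0].
rewrite !big_cons !big_nil !mulr1 -!mulrA => -> //.
by move=> i _; rewrite /residue /=; lia.
Qed.

Lemma dp_product : euler_prod F3 dp_part * E 2 * E 3 = E 1 * E 4 * E 6.
Proof.
have := @euler_prod_count F3 [:: dp_part; residue 2 0; residue 3 0]
  [:: residue 1 0; residue 4 0; residue 6 0].
rewrite !big_cons !big_nil !mulr1 -!mulrA => -> //.
by move=> i _; rewrite /residue /dp_part /dvdn /=; lia.
Qed.

Lemma dp_series_dissections :
  dissect 1 (dp_series F3) = dissect 0 (dissect 2 (dissect 1 (dp_series F3))).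
Proof.
have e3 : E 3 = E 1 ^+ 3 by exact: (@euler_cube 1).
have e6 : E 6 = E 2 ^+ 3 by exact: (@euler_cube 2).
have phi1 : phi 1 * E 2 = E 1 ^+ 2 by exact: (@phi_product 1).
have phi2 : phi 2 * E 4 = E 2 ^+ 2 by exact: (@phi_product 2).
have phi1E := phi_dissection (isT : 0 < 1)%N.
have phi2E := phi_dissection (isT : 0 < 2)%N.
have := omega_product; have := dp_product; rewrite e3 e6.
have := dp_seriesE F3; move: phi1 phi2 phi1E phi2E.
have: E 4 0%N = 1 := euler_prod0 _ _.
have: E 2 0%N = 1 := euler_prod0 _ _.
have: E 1 0%N = 1 := euler_prod0 _ _.
(* [ring] would otherwise compare these series by unfolding them. *)
move: (E 1) (E 2) (E 4) (phi 1) (phi 2) (omega 1) (omega 2)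
  (dp_series F3) (euler_prod F3 dp_part).
move=> x y z u v w w' F D x0 y0 z0 phi1 phi2 phi1E phi2E FD dpE omegaE.
set F1 := dissect 1 F; set F2 := dissect 2 F1.
have one0 f k : f 0 = 1 -> (f ^+ k) 0 = 1.
  move=> f1; elim: k => // k IH; by rewrite exprS fps_coefM0 f1 IH mulr1.
have omegaX : w * x ^+ 2 = y ^+ 5.
  have xy0 : (x * y) 0 = 1 by rewrite fps_coefM0 x0 y0 mulr1.
  apply: (fps_mulI xy0); transitivity (w * y * x ^+ 3); first by ring.
  by rewrite omegaE; ring.
have FE : F * y ^+ 3 = u * v.
  have xyz0 : (x * y * z) 0 = 1 by rewrite !fps_coefM0 x0 y0 z0 !mulr1.
  apply: (fps_mulI xyz0).
  transitivity (F * (x * z * y ^+ 3) * y); first by ring.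
  rewrite -dpE; transitivity (F * D * x ^+ 3 * y ^+ 2); first by ring.
  rewrite FD; transitivity (x * (u * y) * (v * z)); last by ring.
  by rewrite phi1 phi2; ring.
have F1E : F1 * y = w * v ^+ 3.
  have := congr1 (dissect 1) FE; rewrite mulrC dissect_cubeM // mulrC => ->.
  rewrite {1}phi1E {1}phi2E.
  rewrite (_ : _ * _ = (u ^+ 3 * v ^+ 3) ^+ 3 * q ^+ 0 +
     (w * v ^+ 3) ^+ 3 * q ^+ 1 + (u ^+ 3 * w') ^+ 3 * q ^+ 2 +
     (q * w * w') ^+ 3 * q ^+ 0); last by ring.
  by rewrite !dissectD !dissect_cube //= !mulr0n add0r !addr0.
have F1X : F1 * x ^+ 2 * z ^+ 3 = y ^+ 10.
  apply: (fps_mulI y0).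
  transitivity ((F1 * y) * x ^+ 2 * z ^+ 3); first by ring.
  rewrite F1E; transitivity (w * x ^+ 2 * (v * z) ^+ 3); first by ring.
  by rewrite omegaX phi2; ring.
have F1P : (z * x ^+ 2) ^+ 3 * F1 = (y ^+ 4) ^+ 3 * u ^+ 2.
  transitivity (x ^+ 4 * (F1 * x ^+ 2 * z ^+ 3)); first by ring.
  rewrite F1X; transitivity (y ^+ 10 * (x ^+ 2) ^+ 2); first by ring.
  by rewrite -phi1; ring.
have F2E : (z * x ^+ 2) * F2 = y ^+ 4 * w ^+ 2.
  have := congr1 (dissect 2) F1P; rewrite !dissect_cubeM // => ->.
  congr (_ * _).
  rewrite {1}phi1E.
  rewrite (_ : _ ^+ 2 = (u ^+ 6) ^+ 3 * q ^+ 0 +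
     (u ^+ 3 * w) ^+ 3 * q ^+ 1 +
     (u ^+ 3 * w) ^+ 3 * q ^+ 1 + (w ^+ 2) ^+ 3 * q ^+ 2);
     last by ring.
  by rewrite !dissectD !dissect_cube //= !mulr0n !add0r.
have F2P : (x ^+ 2) ^+ 3 * F2 = (y ^+ 4) ^+ 3 * v.
  apply: (fps_mulI z0).
  transitivity (x ^+ 4 * (z * x ^+ 2 * F2)); first by ring.
  rewrite F2E; transitivity (y ^+ 4 * (w * x ^+ 2) ^+ 2); first by ring.
  rewrite omegaX; transitivity (y ^+ 12 * y ^+ 2); first by ring.
  by rewrite -phi2; ring.
have F3E : x ^+ 2 * dissect 0 F2 = y ^+ 4 * v ^+ 3.
  have := congr1 (dissect 0) F2P; rewrite !dissect_cubeM // => ->.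
  congr (_ * _).
  rewrite {1}phi2E.
  rewrite (_ : _ + _ = (v ^+ 3) ^+ 3 * q ^+ 0 + w' ^+ 3 * q ^+ 2); last by ring.
  by rewrite dissectD !dissect_cube //= mulr0n addr0.
have xz0 : (x ^+ 2 * z ^+ 3) 0 = 1 by rewrite fps_coefM0 !one0 ?mulr1.
apply: (fps_mulI xz0).
transitivity (F1 * x ^+ 2 * z ^+ 3); first by ring.
rewrite F1X; transitivity (z ^+ 3 * (x ^+ 2 * dissect 0 F2)); last by ring.
rewrite F3E; transitivity (y ^+ 4 * (v * z) ^+ 3); last by ring.
by rewrite phi2; ring.
Qed.

End Modulo3.

Local Close Scope ring_scope.

Theorem theorem1p5 (n : nat) : dp (27 * n + 7) = dp (3 * n + 1) %[mod 3].
Proof.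
have E : ((dp (27 * n + 7))%:R = (dp (3 * n + 1))%:R :> 'F_3)%R.
  have -> : (27 * n + 7 = 3 * (3 * (3 * n + 0) + 2) + 1)%N by lia.
  by have /(congr1 (fun f : fps 'F_3 => f n)) := dp_series_dissections.
by move: (congr1 val E); rewrite /= !val_Fp_nat.
Qed.
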